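(* Let $k$ be a field, let $A$ be a commutative $k$-algebra, and let $u:A[[t]]\to A[[t]]$ be the $k[[t]]$-linear map determined by $$u(a)=a+u_1(a)t+u_2(a)t^2+\cdots\in A[[t]]\qquad (a\in A),$$ where each $u_i:A\to A$ ($i\ge 1$) is $k$-linear. Consider the identity $$u(ab)\,u(c)=u(a)\,u(bc)\qquad\text{for all } a,b,c. \qquad (\ast)$$ (i) If $u$ satisfies $(\ast)$ modulo $t^2$, then $u_1\in Z^2_{S^2}(A,A)=H^2_{S^2}(A,A)$. (ii) Let $n\ge 1$ and suppose that $u$ satisfies $(\ast)$ modulo $t^{n+1}$. Then $u$ can be extended so that it satisfies $(\ast)$ modulo $t^{n+2}$ (that is, keeping $u_1,\dots,u_n$ fixed, one can choose a $k$-linear map $u_{n+1}:A\to A$ such that $(\ast)$ holds modulo $t^{n+2}$) if and only if $$u_n\circ u_1+u_{n-1}\circ u_2+\cdots+u_1\circ u_n=0\in H^3_{S^2}(A,A).$$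
   Context: All tensor products are over $k$; algebras are associative and unital. The $k[[t]]$-linear map $u$ is given on power series by $u(\sum_i a_i t^i)=\sum_i u(a_i)t^i$. **The complex $C^*_{S^2}(A,A)$.** For $n\ge 0$ let $C^n_{S^2}(A,A)=\mathrm{Hom}_k(A^{\otimes n(n-1)/2},A)$ (with $A^{\otimes 0}=k$). A simple tensor in $A^{\otimes n(n-1)/2}$ is written as a strictly upper triangular array $T=(a_{p,q})_{1\le p<q\le n}$ of elements of $A$ (displayed as an $n\times n$ upper triangular matrix with $1$'s on the diagonal, which play no role). The differential $\delta_n^{S^2}:C^n_{S^2}(A,A)\to C^{n+1}_{S^2}(A,A)$ is defined for $n\ge 1$ on $T=(a_{p,q})_{1\le p<q\le n+1}$ by $$\delta_n^{S^2}(f)(T)=\Big(\prod_{j=2}^{n+1}a_{1,j}\Big)f\big((a_{p,q})_{2\le p<q\le n+1}\big)+\sum_{i=1}^n(-1)^i a_{i,i+1}\,f\big(T^{(i)}\big)+(-1)^{n+1}\Big(\prod_{j=1}^{n}a_{j,n+1}\Big)f\big((a_{p,q})_{1\le p<q\le n}\big),$$ where $T^{(i)}=(b_{r,s})_{1\le r<s\le n}$ is obtained by collapsing rows and columns $i$ and $i+1$: $b_{r,s}=\prod a_{p,q}$ over all $p<q$ with $\sigma_i(p)=r$, $\sigma_i(q)=s$, where $\sigma_i:\{1,\dots,n+1\}\to\{1,\dots,n\}$ is given by $\sigma_i(p)=p$ for $p\le i$ and $\sigma_i(p)=p-1$ for $p\ge i+1$; also $\delta_0^{S^2}=0$. Set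 $Z^n_{S^2}(A,A)=\ker\delta^{S^2}_n$ and $H^n_{S^2}(A,A)=\ker\delta_n^{S^2}/\mathrm{im}\,\delta_{n-1}^{S^2}$ (the higher order Hochschild cohomology of $A$ over $S^2$). In particular $C^2_{S^2}(A,A)=\mathrm{Hom}_k(A,A)$, and for $f\in C^2_{S^2}(A,A)$, writing $a=a_{1,2}$, $b=a_{1,3}$, $c=a_{2,3}$, $$\delta_2^{S^2}(f)(a\otimes b\otimes c)=ab f(c)-a f(bc)+c f(ab)-bc f(a).$$ **The operation $\circ$.** For $k$-linear $f,g:A\to A$, define $f\circ g\in C^3_{S^2}(A,A)=\mathrm{Hom}_k(A^{\otimes 3},A)$, with the same notation $a=a_{1,2}$, $b=a_{1,3}$, $c=a_{2,3}$, by $$(f\circ g)(a\otimes b\otimes c)=f(bc)g(a)-f(ab)g(c).$$ An expression in $C^3_{S^2}(A,A)$ being ''$0\in H^3_{S^2}(A,A)$'' means that it is a coboundary, i.e. lies in $\mathrm{im}\,\delta_2^{S^2}$.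
   Formalization: In (i) only u_1 ∈ Z^2 is asserted; the equality Z^2 = H^2 is dropped, since with the given differential δ_1(f)(a) = af, so the identity map is a nonzero coboundary and the equality fails for every nonzero A. *)

(* Defs.v *)
From HB Require Import structures.
From mathcomp Require Import all_boot all_order all_algebra.

Set Implicit Arguments.
Unset Strict Implicit.
Unset Printing Implicit Defensive.

Import GRing.Theory.
Local Open Scope ring_scope.

(* Positions (p, q) with p < q. Rows and columns are numbered from 0, whereas
   the usual notation for these arrays numbers them from 1. *)
Notation upos n := {x : 'I_n * 'I_n | (x.1 < x.2)%N}.

Definition array (A : Type) (n : nat) : Type := {ffun upos n -> A}.

(* The matrix of an array, completed with 1 on (and below) the diagonal. *)
Definition entry (A : pzSemiRingType) n (T : array A n) (p q : 'I_n) : A :=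
  if insub (p, q) is Some x then T x else 1.

Definition replace (A : Type) n (T : array A n) (x : upos n) (a : A)
  : array A n := [ffun y => if y == x then a else T y].

Section Complex.

Variables (k : fieldType) (A : comAlgType k).
Implicit Type n : nat.

(* A k-linear map on the tensor power of A indexed by [upos n] is encoded, by
   the universal property, as a function of arrays that is k-linear in each
   entry. For n <= 1 there is a single array, and such a function is just an
   element of A. *)
Definition cochain n (f : array A n -> A) : Prop :=
  forall (T : array A n) (x : upos n) (c : k) (a b : A),
    f (replace T x (c *: a + b))
    = c *: f (replace T x a) + f (replace T x b).

Definition del_first n (T : array A n.+1) : array A n :=
  [ffun x : upos n => entry T (lift ord0 (val x).1) (lift ord0 (val x).2)].

Definition del_last n (T : array A n.+1) : array A n :=
  [ffun x : upos n => entry T (widen_ord (leqnSn n) (val x).1)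
                              (widen_ord (leqnSn n) (val x).2)].

(* [unbump i] fixes every p <= i and sends every p > i to p - 1. *)
Definition collapse n (i : 'I_n) (T : array A n.+1) : array A n :=
  [ffun x : upos n => \prod_(y : upos n.+1 |
     (unbump i (val y).1 == (val x).1) && (unbump i (val y).2 == (val x).2))
     T y].

(* For n = 0 the formula gives 0. *)
Definition delta n (f : array A n -> A) (T : array A n.+1) : A :=
  (\prod_(j < n) entry T ord0 (lift ord0 j)) * f (del_first T)
  + \sum_(i < n) (-1) ^+ i.+1
      * (entry T (widen_ord (leqnSn n) i) (lift ord0 i) * f (collapse i T))
  + (-1) ^+ n.+1
      * ((\prod_(j < n) entry T (widen_ord (leqnSn n) j) ord_max)
         * f (del_last T)).

Definition cocycle n (f : array A n -> A) : Prop :=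
  cochain f /\ forall T, delta f T = 0.

(* [coboundary f] says that f represents 0 in H^n. *)
Definition coboundary n : (array A n -> A) -> Prop :=
  match n with
  | 0 => fun f => forall T, f T = 0
  | m.+1 => fun f => exists2 g : array A m -> A,
                       cochain g & forall T, f T = delta g T
  end.

Definition i0 : 'I_3 := @Ordinal 3 0 isT.
Definition i1 : 'I_3 := @Ordinal 3 1 isT.
Definition i2 : 'I_3 := @Ordinal 3 2 isT.

Definition cochain2 (f : A -> A) (T : array A 2) : A := f (entry T ord0 ord_max).

Definition circ (f g : A -> A) (T : array A 3) : A :=
  let a := entry T i0 i1 in let b := entry T i0 i2 in let c := entry T i1 i2 in
  f (b * c) * g a - f (a * b) * g c.

(* A power series is its sequence of coefficients. *)
Definition series : Type := nat -> A.

Definition series_mul (x y : series) : series :=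
  fun m => \sum_(i < m.+1) x i * y (m - i)%N.

(* The k[[t]]-linear map A[[t]] -> A[[t]] sending a in A to the sum of the
   u_i(a) t^i. *)
Definition series_map (u : nat -> {linear A -> A}) (x : series) : series :=
  fun m => \sum_(i < m.+1) u i (x (m - i)%N).

(* u(ab) u(c) = u(a) u(bc) modulo t^m. *)
Definition star_mod (u : nat -> {linear A -> A}) (m : nat) : Prop :=
  forall (a b c : series) (j : nat), (j < m)%N ->
    series_mul (series_map u (series_mul a b)) (series_map u c) j
    = series_mul (series_map u a) (series_map u (series_mul b c)) j.

Definition set_coef (u : nat -> {linear A -> A}) (m : nat)
    (v : {linear A -> A}) : nat -> {linear A -> A} :=
  fun i => if i == m then v else u i.

Lemma entryE n (T : array A n) (x : upos n) : entry T (val x).1 (val x).2 = T x.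
Proof. by rewrite /entry -surjective_pairing valK. Qed.

Lemma big_upos n (T : array A n) (P : pred ('I_n * 'I_n)) :
  \prod_(y : upos n | P (val y)) T y
  = \prod_(p < n) \prod_(q < n | (p < q)%N && P (p, q)) entry T p q.
Proof.
rewrite pair_big_dep /= (reindex_omap (val : upos n -> _) insub) /=.
  apply: eq_big => [y|y _]; last by rewrite entryE.
  by rewrite valK eqxx andbT (valP y) -surjective_pairing.
by move=> z /andP[z_lt _]; rewrite insubT.
Qed.

Lemma collapseE n (i : 'I_n) (T : array A n.+1) (x : upos n) :
  collapse i T x
  = \prod_(p < n.+1) \prod_(q < n.+1 | (p < q)%N &&
      ((unbump i p == (val x).1) && (unbump i q == (val x).2))) entry T p q.
Proof.
by rewrite ffunE (big_upos T (fun y =>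
  (unbump i y.1 == (val x).1) && (unbump i y.2 == (val x).2))).
Qed.

(* The coboundaries in degree 2 are the multiplications by elements of A, so
   H^2 is a proper quotient of Z^2. *)
Lemma delta1E (f : array A 1 -> A) (T : array A 2) (E : array A 1) :
  delta f T = entry T ord0 ord_max * f E.
Proof.
have no x : upos 1 -> x by case=> -[i j] /=; rewrite !ord1.
have fE E' : f E' = f E by congr f; apply/ffunP=> x; exact: no.
rewrite /delta !big_ord1 !fE.
have -> : lift ord0 ord0 = ord_max :> 'I_2 by apply: val_inj.
have -> : widen_ord (leqnSn 1) ord0 = ord0 by apply: val_inj.
by rewrite expr1 mulN1r sqrrN expr1n mul1r subrK.
Qed.

Lemma delta2E (f : A -> A) (T : array A 3) :
  let a := entry T i0 i1 in let b := entry T i0 i2 in let c := entry T i1 i2 in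
  delta (cochain2 f) T
  = a * b * f c - a * f (b * c) + c * f (a * b) - b * c * f a.
Proof.
pose x : upos 2 := exist _ (ord0, ord_max) isT.
have entry2 (S : array A 2) : entry S ord0 ord_max = S x by rewrite -entryE.
rewrite /cochain2 /delta !big_ord_recl !big_ord0 !entry2 !collapseE !ffunE /=.
do ?rewrite ?[\prod_(_ < _ | _) _]big_mkcond !big_ord_recl !big_ord0 /=.
have E0 : widen_ord (leqnSn 2) ord0 = i0 by apply: val_inj.
have E0' : ord0 = i0 by apply: val_inj.
have E1 : lift ord0 ord0 = i1 by apply: val_inj.
have E1' : widen_ord (leqnSn 2) (lift ord0 ord0) = i1 by apply: val_inj.
have E1'' : widen_ord (leqnSn 2) ord_max = i1 by apply: val_inj.
have E2 : lift ord0 (lift ord0 ord0) = i2 by apply: val_inj.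
have E2' : lift ord0 ord_max = i2 by apply: val_inj.
have E2'' : ord_max = i2 by apply: val_inj.
rewrite E1' E2 E2' E1'' E1 E0 E0' E2'' !mul1r !mulr1 addr0 /bump leqnn.
by rewrite !exprS expr0 !mulr1 !(mulrNN, mul1r, mulr1) !mulN1r !addrA.
Qed.

End Complex.

(* Main.v *)
Require Import Defs.
From HB Require Import structures.
From mathcomp Require Import all_boot all_order all_algebra ring.
From Stdlib Require Import FunctionalExtensionality.

Set Implicit Arguments.
Unset Strict Implicit.
Unset Printing Implicit Defensive.

Import GRing.Theory.
Local Open Scope ring_scope.

(** Since [u] is k[[t]]-linear, both sides of u(ab)u(c) = u(a)u(bc) are
    k[[t]]-trilinear in (a, b, c), so modulo [t^m] the identity holds for all
    power series as soon as it holds for constant ones ([star_modP]).  For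
    constants, the coefficient of [t^(n+1)] reads
    [\sum_i u_i(ab) u_(n+1-i)(c) = \sum_i u_i(a) u_(n+1-i)(bc)].  As [u_0] is
    the identity, the four terms containing [u_(n+1)] are exactly those of
    [delta u_(n+1)], and the remaining ones, moved to the other side, are the
    sum of the [u_(n+1-i) o u_i] for [1 <= i <= n] ([star_coef_delta]).

    Hence, once the identity is known modulo [t^(n+1)], it lifts modulo
    [t^(n+2)] through a given [u_(n+1)] exactly when [delta u_(n+1)] equals
    this sum ([star_mod_succ]).  For [n = 0] the sum is empty and [u_1] is a
    cocycle; for [n >= 1], letting [u_(n+1)] vary, the sum has to be a
    coboundary, because every degree 2 cochain comes from a linear map
    ([cochain2_surj]). *)

(** * Reduction of the identity to constant power series *)

Section Series.

Variables (k : fieldType) (A : comAlgType k).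
Implicit Types (x y z a b c : series A) (u : nat -> {linear A -> A}).

Definition series_const (r : A) : series A := fun i => if i is 0%N then r else 0.

Definition series_add x y : series A := fun i => x i + y i.

(** Multiplication by [t]. *)
Definition series_shift x : series A := fun i => if i is i'.+1 then x i' else 0.

Lemma series_split x :
  x = series_add (series_const (x 0%N)) (series_shift (fun i => x i.+1)).
Proof.
by apply: functional_extensionality => -[|i]; rewrite /series_add /= ?addr0 ?add0r.
Qed.

Lemma series_mulC x y : series_mul x y = series_mul y x.
Proof.
apply: functional_extensionality => m; rewrite /series_mul.
rewrite (reindex_inj rev_ord_inj) /=; apply: eq_bigr => i _.
by rewrite subSS subKn ?leq_ord// mulrC.
Qed.

Lemma series_mulDl x y z :
  series_mul (series_add x y) z = series_add (series_mul x z) (series_mul y z).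
Proof.
apply: functional_extensionality => m.
by rewrite /series_mul /series_add -big_split; apply: eq_bigr => i _; rewrite mulrDl.
Qed.

Lemma series_mulDr x y z :
  series_mul z (series_add x y) = series_add (series_mul z x) (series_mul z y).
Proof. by rewrite series_mulC series_mulDl !(series_mulC z). Qed.

Lemma series_mul_shiftl x y :
  series_mul (series_shift x) y = series_shift (series_mul x y).
Proof.
apply: functional_extensionality => -[|m]; rewrite /series_mul /=.
  by rewrite big_ord1 mul0r.
by rewrite big_ord_recl /= mul0r add0r; apply: eq_bigr => i _; rewrite subSS.
Qed.

Lemma series_mul_shiftr x y :
  series_mul y (series_shift x) = series_shift (series_mul y x).
Proof. by rewrite series_mulC series_mul_shiftl series_mulC. Qed.

Lemma series_mapD u x y :
  series_map u (series_add x y) = series_add (series_map u x) (series_map u y).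
Proof.
apply: functional_extensionality => m.
by rewrite /series_map /series_add -big_split; apply: eq_bigr => i _; rewrite raddfD.
Qed.

Lemma series_map_shift u x :
  series_map u (series_shift x) = series_shift (series_map u x).
Proof.
apply: functional_extensionality => -[|m]; rewrite /series_map.
  by rewrite big_ord1 /= raddf0.
rewrite big_ord_recr /= subnn raddf0 addr0.
by apply: eq_bigr => i _; rewrite subSn ?leq_ord.
Qed.

Lemma series_mul_const (r s : A) :
  series_mul (series_const r) (series_const s) = series_const (r * s).
Proof.
apply: functional_extensionality => m; rewrite /series_mul big_ord_recl /=.
rewrite big1 => [|i _]; last by rewrite mul0r.
by rewrite addr0 subn0; case: m => //= m; rewrite mulr0.
Qed.

Lemma series_map_const u (r : A) :
  series_map u (series_const r) = fun m => u m r.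
Proof.
apply: functional_extensionality => m; rewrite /series_map big_ord_recr /= subnn.
rewrite big1 ?add0r // => i _.
by have := ltn_ord i; rewrite -subn_gt0; case: (m - i)%N => //=; rewrite raddf0.
Qed.

Definition star_lhs u a b c : series A :=
  series_mul (series_map u (series_mul a b)) (series_map u c).

(** Commutativity exchanges the two sides of the identity, so that only one
    of them has to be analysed. *)
Lemma star_rhsE u a b c :
  series_mul (series_map u a) (series_map u (series_mul b c)) = star_lhs u c b a.
Proof. by rewrite /star_lhs series_mulC (series_mulC b). Qed.

Definition series_bilin :=
  (series_mulDl, series_mulDr, series_mapD, series_mul_shiftl,
   series_mul_shiftr, series_map_shift).

Lemma star_lhs_split1 u a b c :
  star_lhs u a b c = series_add (star_lhs u (series_const (a 0%N)) b c)
    (series_shift (star_lhs u (fun i => a i.+1) b c)).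
Proof. by rewrite {1}/star_lhs {1}(series_split a) !series_bilin. Qed.

Lemma star_lhs_split2 u a b c :
  star_lhs u a b c = series_add (star_lhs u a (series_const (b 0%N)) c)
    (series_shift (star_lhs u a (fun i => b i.+1) c)).
Proof. by rewrite {1}/star_lhs {1}(series_split b) !series_bilin. Qed.

Lemma star_lhs_split3 u a b c :
  star_lhs u a b c = series_add (star_lhs u a b (series_const (c 0%N)))
    (series_shift (star_lhs u a b (fun i => c i.+1))).
Proof. by rewrite {1}/star_lhs {1}(series_split c) !series_bilin. Qed.

Lemma star_lhs_const u (a b c : A) j :
  star_lhs u (series_const a) (series_const b) (series_const c) j
  = \sum_(i < j.+1) u i (a * b) * u (j - i)%N c.
Proof. by rewrite /star_lhs series_mul_const !series_map_const. Qed.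

(** The coefficient of [t^j] in u(ab)u(c) = u(a)u(bc), for constant
    [a], [b], [c]. *)
Definition star_coef u j : Prop := forall a b c : A,
  \sum_(i < j.+1) u i (a * b) * u (j - i)%N c
  = \sum_(i < j.+1) u i a * u (j - i)%N (b * c).

(** Writing a series as its constant term plus [t] times another series, the
    coefficient of [t^j] at that series becomes the one at the constant plus a
    coefficient of [t^(j-1)], which induction on [j] takes care of. *)
Lemma star_modP u m :
  star_mod u m <-> forall j, (j < m)%N -> star_coef u j.
Proof.
have constR (a b c : A) j : \sum_(i < j.+1) u i a * u (j - i)%N (b * c) =
    star_lhs u (series_const c) (series_const b) (series_const a) j.
  by rewrite -star_rhsE series_mul_const !series_map_const.
split=> [star_u j j_lt a b c | coef_u a b c j].
  rewrite -star_lhs_const constR.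
  have := star_u (series_const a) (series_const b) (series_const c) j j_lt.
  by rewrite star_rhsE.
rewrite -/(star_lhs u a b c j) star_rhsE.
have eq_shift (x y : series A) i :
    (forall l, (l < i)%N -> x l = y l) -> series_shift x i = series_shift y i.
  by case: i => //= i; apply.
elim/ltn_ind: j => j IHj in a b c * => j_lt.
have {}IHj a' b' c' : series_shift (star_lhs u a' b' c') j
                      = series_shift (star_lhs u c' b' a') j.
  by apply: eq_shift => l l_lt; apply: IHj (ltn_trans l_lt j_lt).
(* In turn, [a], [b] and [c] are replaced with their constant terms on both
   sides; [IHj] equates what is left over. *)
rewrite (star_lhs_split1 u a) (star_lhs_split3 u _ _ a) /series_add IHj.
congr (_ + _).
rewrite (star_lhs_split2 u _ b) (star_lhs_split2 u c b) /series_add IHj.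
congr (_ + _).
rewrite (star_lhs_split3 u _ _ c) (star_lhs_split1 u c) /series_add IHj.
congr (_ + _).
by rewrite star_lhs_const coef_u // constR.
Qed.

End Series.

(** * Cochains of degree 2 and arrays of size 3 *)

Section LowDegree.

Variables (k : fieldType) (A : comAlgType k).

Definition corner : upos 2 := exist _ (ord0, ord_max) isT.

Lemma upos2_corner (x : upos 2) : x = corner.
Proof.
apply: val_inj; case: x => -[[[|[]]//= ?] [[|[]]//= ?]] //= _.
by congr (_, _); apply: val_inj.
Qed.

Lemma entry_corner (T : array A 2) : entry T ord0 ord_max = T corner.
Proof. exact: (entryE T corner). Qed.

Lemma cochain2_linear (f : {linear A -> A}) : cochain (cochain2 f).
Proof.
move=> T x c a b; rewrite /cochain2 !entry_corner !ffunE.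
by rewrite (upos2_corner x) eqxx linearP.
Qed.

(** An array of size 2 has a single entry, so being linear in each entry is
    plain linearity. *)
Lemma cochain2_surj (g : array A 2 -> A) : cochain g ->
  exists v : {linear A -> A}, forall T, g T = cochain2 v T.
Proof.
move=> g_lin; pose v (a : A) := g [ffun=> a].
have vE a : v a = g (replace [ffun=> 0] corner a).
  by congr g; apply/ffunP=> x; rewrite !ffunE (upos2_corner x) eqxx.
have v_lin : linear v by move=> c a b; rewrite !vE g_lin.
pose V := GRing.isLinear.Build k A A *:%R v v_lin.
pose vL : {linear A -> A} := HB.pack v V.
exists vL => T; rewrite /cochain2 entry_corner /= /v; congr g.
by apply/ffunP=> x; rewrite ffunE (upos2_corner x).
Qed.

Lemma eq_delta n (f g : array A n -> A) : f =1 g -> delta f =1 delta g.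
Proof.
move=> fg T; rewrite /delta !fg; congr (_ + _ + _).
by apply: eq_bigr => i _; rewrite fg.
Qed.

Lemma exists_array3 (a b c : A) : exists T : array A 3,
  [/\ entry T i0 i1 = a, entry T i0 i2 = b & entry T i1 i2 = c].
Proof.
pose x01 : upos 3 := exist _ (i0, i1) isT.
pose x02 : upos 3 := exist _ (i0, i2) isT.
pose x12 : upos 3 := exist _ (i1, i2) isT.
exists [ffun x => if x == x01 then a else if x == x02 then b else c].
by split; [rewrite (entryE _ x01) | rewrite (entryE _ x02)
          | rewrite (entryE _ x12)]; rewrite ffunE.
Qed.

End LowDegree.

(** * The obstruction *)

Section Obstruction.

Variables (k : fieldType) (A : comAlgType k).
Implicit Types u w : nat -> {linear A -> A}.

Lemma cauchy_ends (x y : nat -> A) n :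
  \sum_(i < n.+2) x i * y (n.+1 - i)%N
  = x 0%N * y n.+1 + x n.+1 * y 0%N
    + \sum_(1 <= i < n.+1) y (n.+1 - i)%N * x i.
Proof.
rewrite -(big_mkord xpredT (fun i => x i * y (n.+1 - i)%N)).
rewrite big_nat_recr //= big_ltn // subn0 subnn addrAC; congr (_ + _).
by apply: eq_bigr => i _; rewrite mulrC.
Qed.

(** The terms [i = 0] and [i = n+1] of the two Cauchy products make up
    [delta], because [w 0] is the identity; all the others only involve
    [w 1], ..., [w n] and form the obstruction. *)
Lemma star_coef_delta w n : (forall a, w 0%N a = a) ->
  star_coef w n.+1 <-> forall T,
    delta (cochain2 (w n.+1)) T
    = \sum_(1 <= i < n.+1) circ (w (n.+1 - i)%N) (w i) T.
Proof.
move=> w0.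
have coefE (a b c : A) :
    (\sum_(i < n.+2) w i (a * b) * w (n.+1 - i)%N c =
     \sum_(i < n.+2) w i a * w (n.+1 - i)%N (b * c)) <->
    (a * b * w n.+1 c - a * w n.+1 (b * c) + c * w n.+1 (a * b)
       - b * c * w n.+1 a =
     \sum_(1 <= i < n.+1)
       (w (n.+1 - i)%N (b * c) * w i a - w (n.+1 - i)%N (a * b) * w i c)).
  (* Reversing the left-hand sum puts the argument [a * b] under
     [w (n.+1 - i)], as in [circ]. *)
  have := series_mulC (fun i => w i (a * b)) (fun i => w i c).
  move=> /(congr1 (fun s => s n.+1)); rewrite /series_mul => ->.
  rewrite (cauchy_ends (fun i => w i c) (fun i => w i (a * b))).
  rewrite (cauchy_ends (fun i => w i a) (fun i => w i (b * c))).
  rewrite sumrB /= !w0.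
  set S1 := \sum_(_ <= _ < _) _; set S2 := \sum_(_ <= _ < _) _.
  split=> [E|E].
    apply/eqP; rewrite -subr_eq0; apply/eqP; move/eqP: E; rewrite -subr_eq0.
    by move/eqP=> <-; ring.
  apply/eqP; rewrite -subr_eq0; apply/eqP; move/eqP: E; rewrite -subr_eq0.
  by move/eqP=> <-; ring.
split=> [coef_w T | delta_w a b c].
  by rewrite delta2E; apply/coefE/coef_w.
have [T [Ea Eb Ec]] := exists_array3 a b c.
by apply/coefE; move: (delta_w T); rewrite delta2E /circ Ea Eb Ec.
Qed.

(** Lower coefficients do not involve [w (n.+1)], so lifting the identity by
    one order is a condition on [delta] of [w (n.+1)] alone. *)
Lemma star_mod_succ w n : (forall a, w 0%N a = a) -> star_mod w n.+1 ->
  star_mod w n.+2 <-> forall T,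
    delta (cochain2 (w n.+1)) T
    = \sum_(1 <= i < n.+1) circ (w (n.+1 - i)%N) (w i) T.
Proof.
move=> w0 /star_modP w_n; split.
  by move=> /star_modP w_n1; apply/star_coef_delta => //; apply: w_n1.
move=> /(star_coef_delta _ w0) w_n1; apply/star_modP => j.
by rewrite ltnS leq_eqVlt => /predU1P[-> // | /w_n].
Qed.

Lemma star_mod_eq u w m : (forall i, (i < m)%N -> u i = w i) ->
  star_mod u m -> star_mod w m.
Proof.
move=> uw /star_modP star_u; apply/star_modP => j j_lt a b c.
have := star_u j j_lt a b c.
have uwj (i : 'I_j.+1) : w i = u i.
  by rewrite uw // (leq_trans (ltn_ord i)).
have uwjB (i : 'I_j.+1) : w (j - i)%N = u (j - i)%N.
  by rewrite uw // (leq_ltn_trans (leq_subr _ _)).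
under eq_bigr do rewrite -uwj -uwjB.
by move->; apply: eq_bigr => i _; rewrite uwj uwjB.
Qed.

Lemma star_mod1 u : (forall a, u 0%N a = a) -> star_mod u 1.
Proof.
move=> u0; apply/star_modP => -[|//] _ a b c.
by rewrite !big_ord1 /= !u0 mulrA.
Qed.

End Obstruction.

Theorem theorem3p1 (k : fieldType) (A : comAlgType k)
    (u : nat -> {linear A -> A}) (u0 : forall a : A, u 0%N a = a) :
  (star_mod u 2 -> cocycle (cochain2 (u 1%N)))
  /\
  (forall n : nat, (1 <= n)%N -> star_mod u n.+1 ->
     (exists v : {linear A -> A}, star_mod (set_coef u n.+1 v) n.+2)
     <->
     coboundary (fun T : array A 3 =>
       \sum_(1 <= i < n.+1) circ (u (n.+1 - i)%N) (u i) T)).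
Proof.
split=> [|n n_gt0 star_u].
  move/(star_mod_succ u0 (star_mod1 u0)) => delta_u1.
  split=> [|T]; first exact: cochain2_linear.
  by rewrite delta_u1 big_geq.
have set_lt v i : (i < n.+1)%N -> u i = set_coef u n.+1 v i.
  by move=> i_lt; rewrite /set_coef ltn_eqF.
have star_set v : star_mod (set_coef u n.+1 v) n.+2 <-> forall T,
    delta (cochain2 v) T = \sum_(1 <= i < n.+1) circ (u (n.+1 - i)%N) (u i) T.
  have circE T : \sum_(1 <= i < n.+1) circ (u (n.+1 - i)%N) (u i) T =
      \sum_(1 <= i < n.+1)
        circ (set_coef u n.+1 v (n.+1 - i)%N) (set_coef u n.+1 v i) T.
    apply: eq_big_nat => i /andP[i_gt0 i_lt].
    by rewrite -!set_lt // ltn_subrL i_gt0.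
  have := @star_mod_succ _ _ (set_coef u n.+1 v) n u0
    (star_mod_eq (set_lt v) star_u).
  rewrite {2}/set_coef eqxx => ->.
  by split=> E T; rewrite E circE.
split=> [[v /star_set delta_v] | [g /cochain2_surj[v gE] delta_g]].
  by exists (cochain2 v) => [|T]; [exact: cochain2_linear | rewrite delta_v].
by exists v; apply/star_set => T; rewrite delta_g (eq_delta gE).
Qed.
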